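(* Let $X$ be a totally ordered set. The set $[P(X)]=\{[a] : a\in P(X)\}$ is a linear basis of $\mathrm{DerPerm}_{\succ}\langle X\rangle$; that is, the elements $\tau([a])$, $a\in P(X)$, obtained by evaluating the words $[a]$ in $\mathrm{DerPerm}_{\succ}\langle X\rangle$, are pairwise distinct and form a basis of the vector space $\mathrm{DerPerm}_{\succ}\langle X\rangle$.
   Context: All algebras are over a fixed field. A perm algebra is an associative (not necessarily unital) algebra satisfying $abc=bac$. $\mathrm{DerPerm}\langle X\rangle$ is the free perm algebra with a derivation $d$ generated by $X$; as a perm algebra it is the free perm algebra on the symbols $x^{(k)}=d^k(x)$, $x\in X$, $k\ge 0$ ($x^{(0)}=x$, $x^{(1)}=x'$). In a monomial (a product of such symbols) all factors except the last may be permuted freely. $\mathrm{DerPerm}_{\succ}\langle X\rangle$ is the subalgebra generated by $X$ of $\mathrm{DerPerm}\langle X\rangle$ under the single operation $a\succ b=d(a)b$. The weight of a monomial is given by $\mathrm{wt}(x^{(j)})=j-1$, $\mathrm{wt}(uv)=\mathrm{wt}(u)+\mathrm{wt}(v)$. Order the symbols: $x_i^{(r)}>x_j^{(s)}$ if $r>s$, or $r=s$ and $x_i>x_j$ in $X$. $P(X)$ is the set of monomials of weight $-1$ whose last factor has derivation order $0$, each written in the normal form $$a=x_{k_1}'\cdots x_{k_m}'\,x_{j_1}^{(r_1)}\cdots x_{j_n}^{(r_n)}\,x_{i_l}\cdots x_{i_2}x_{i_1},$$ with $m,n\ge 0$, $l\ge 1$, all $r_t\ge 2$, $x_{k_m}\ge\dots\ge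 x_{k_1}$, $x_{j_n}^{(r_n)}\ge\dots\ge x_{j_1}^{(r_1)}$, $x_{i_l}\ge\dots\ge x_{i_2}$ (no condition on $x_{i_1}$). The weight condition means $r_1+\dots+r_n=n+l-1$. $\mathrm{Magma}\langle X\rangle$ is the free nonassociative (magma) algebra on $X$ with operation $\succ$. To $a\in P(X)$ one associates a nonassociative word $[a]=\phi(a)\in\mathrm{Magma}\langle X\rangle$ as follows. If $n=0$ (so $l=1$), $[a]=x_{k_1}\succ(x_{k_2}\succ(\cdots(x_{k_m}\succ x_{i_1})\cdots))$. If $n\ge 1$, start with the list $(x_{i_l},\dots,x_{i_2},x_{i_1})$. For $t=n,n-1,\dots,1$ successively: remove the first $r_t$ entries $y_1,\dots,y_{r_t}$ of the current list, form the left-normed word $Q_t=(\cdots((x_{j_t}\succ y_1)\succ y_2)\cdots)\succ y_{r_t}$, and, if $t>1$, put $Q_t$ as a new first entry of the remaining list. (Because $r_1+\dots+r_n=n+l-1$, the list is exactly used up at $t=1$, and $x_{i_1}$ is the last entry used.) Then $[a]=x_{k_1}\succ(x_{k_2}\succ(\cdots(x_{k_m}\succ Q_1)\cdots))$. $\tau:\mathrm{Magma}\langle X\rangle\to\mathrm{DerPerm}\langle X\rangle$ is the linear evaluation map with $\tau(x)=x$ for $x\in X$ and $\tau(u\succ v)=d(\tau(u))\tau(v)$; its image is $\mathrm{DerPerm}_{\succ}\langle X\rangle$. *)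

(* Defs.v *)
From HB Require Import structures.
From mathcomp Require Import all_boot all_order all_algebra.

Set Implicit Arguments.
Unset Strict Implicit.
Unset Printing Implicit Defensive.

Import Order.TTheory GRing.Theory Num.Theory.
Local Open Scope ring_scope.

(* Products are written [pmul a b] because MathComp's algebras are unital, and
   perm algebras need not be. *)
HB.mixin Record Lmodule_isPermAlg (F : fieldType) A of GRing.Lmodule F A := {
  pmul : A -> A -> A;
  pmulDl : left_distributive pmul +%R;
  pmulDr : right_distributive pmul +%R;
  pmulZl : forall (c : F) (a b : A), pmul (c *: a) b = c *: pmul a b;
  pmulZr : forall (c : F) (a b : A), pmul a (c *: b) = c *: pmul a b;
  pmulA : associative pmul;
  pmul_perm : forall a b c : A, pmul (pmul a b) c = pmul (pmul b a) c
}.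

#[short(type="permAlgType")]
HB.structure Definition PermAlg (F : fieldType) :=
  {A of GRing.Lmodule F A & Lmodule_isPermAlg F A}.

HB.mixin Record PermAlg_hasDer (F : fieldType) A of PermAlg F A := {
  der : A -> A;
  derD : forall a b : A, der (a + b) = der a + der b;
  derZ : forall (c : F) (a : A), der (c *: a) = c *: der a;
  derM : forall a b : A, der (pmul a b) = pmul (der a) b + pmul a (der b)
}.

#[short(type="derPermAlgType")]
HB.structure Definition DerPermAlg (F : fieldType) :=
  {A of PermAlg F A & PermAlg_hasDer F A}.

Definition derperm_morphism (F : fieldType) (A B : derPermAlgType F)
    (f : {linear A -> B}) : Prop :=
  {morph f : a b / pmul a b} /\ {morph f : a / der a}.

(* Universal property: [D], with [iota : X -> D], is the free perm algebra with
   a derivation generated by [X]. *)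
Definition is_free_derperm (F : fieldType) (X : Type) (D : derPermAlgType F)
    (iota : X -> D) : Prop :=
  forall (A : derPermAlgType F) (g : X -> A),
    (exists f : {linear D -> A},
        derperm_morphism f /\ forall x, f (iota x) = g x) /\
    (forall f1 f2 : {linear D -> A},
        derperm_morphism f1 -> derperm_morphism f2 ->
        (forall x, f1 (iota x) = g x) -> (forall x, f2 (iota x) = g x) ->
        f1 =1 f2).

Definition succ_op (F : fieldType) (D : derPermAlgType F) (a b : D) : D :=
  pmul (der a) b.

Inductive succ_subalg (F : fieldType) (X : Type) (D : derPermAlgType F)
    (iota : X -> D) : D -> Prop :=
| Succ_gen x : succ_subalg iota (iota x)
| Succ_0 : succ_subalg iota 0
| Succ_add u v :
    succ_subalg iota u -> succ_subalg iota v -> succ_subalg iota (u + v)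
| Succ_scale (c : F) u : succ_subalg iota u -> succ_subalg iota (c *: u)
| Succ_op u v :
    succ_subalg iota u -> succ_subalg iota v ->
    succ_subalg iota (succ_op u v).

(* Nonassociative words, i.e. the monomial basis of the free magma algebra. *)
Inductive magma (X : Type) : Type :=
| Leaf of X
| Node of magma X & magma X.

Fixpoint tau (F : fieldType) (X : Type) (D : derPermAlgType F) (iota : X -> D)
    (w : magma X) : D :=
  match w with
  | Leaf x => iota x
  | Node u v => succ_op (tau iota u) (tau iota v)
  end.

(* The pair [(x, r)] stands for the symbol x^(r). *)
Definition symb (X : Type) : Type := (X * nat)%type.

Definition symb_le (d : Order.disp_t) (X : orderType d) (a b : symb X) : bool :=
  (a.2 < b.2)%N || ((a.2 == b.2) && (a.1 <= b.1)%O).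

(* Weight of a monomial given as the sequence of its factors. *)
Definition wt (X : Type) (w : seq (symb X)) : int :=
  \sum_(a <- w) (a.2%:Z - 1).

(* The data of a normal form
     x_{k_1}' ... x_{k_m}' x_{j_1}^(r_1) ... x_{j_n}^(r_n) x_{i_l} ... x_{i_1}:
     nf_k    = [:: x_{k_1}; ...; x_{k_m}],
     nf_j    = [:: (x_{j_1}, r_1); ...; (x_{j_n}, r_n)],
     nf_i    = [:: x_{i_l}; ...; x_{i_2}],
     nf_last = x_{i_1}. *)
Record nform (X : Type) : Type := NForm {
  nf_k : seq X;
  nf_j : seq (symb X);
  nf_i : seq X;
  nf_last : X
}.

Definition nf_word (X : Type) (a : nform X) : seq (symb X) :=
  [seq (x, 1%N) | x <- nf_k a] ++ nf_j a
    ++ [seq (x, 0%N) | x <- rcons (nf_i a) (nf_last a)].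

(* Membership in P(X). The condition on the last factor is built into [nf_word]. *)
Definition inP (d : Order.disp_t) (X : orderType d) (a : nform X) : bool :=
  [&& all (fun s => (2 <= s.2)%N) (nf_j a),
      sorted (fun x y => (x <= y)%O) (nf_k a),
      sorted (@symb_le d X) (nf_j a),
      sorted (fun x y => (y <= x)%O) (nf_i a)
    & wt (nf_word a) == -1].

(* One step of the construction: consume the first [s.2] entries [y_1, y_2, ...]
   of [L] and put (..((s.1 > y_1) > y_2)..) in front of the remaining ones. *)
Definition nf_step (X : Type) (s : symb X) (L : seq (magma X)) :
    seq (magma X) :=
  foldl (@Node X) (Leaf s.1) (take s.2 L) :: drop s.2 L.

(* The word [a]. [foldr] performs the steps in the order t = n, ..., 1. For [a]
   in P(X) the resulting list is a singleton, namely [:: Q_1] if n >= 1 and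
   [:: x_{i_1}] if n = 0; the default value given to [head] is never used. *)
Definition phi (X : Type) (a : nform X) : magma X :=
  let x1 := Leaf (nf_last a) in
  let L := foldr (@nf_step X) (rcons (map (@Leaf X) (nf_i a)) x1) (nf_j a) in
  foldr (fun x w => Node (Leaf x) w) (head x1 L) (nf_k a).

Definition lin_indep (F : fieldType) (V : lmodType F) (B : V -> Prop) : Prop :=
  forall (s : seq V) (c : V -> F),
    uniq s -> (forall v, v \in s -> B v) ->
    \sum_(v <- s) c v *: v = 0 -> forall v, v \in s -> c v = 0.

Definition lin_span (F : fieldType) (V : lmodType F) (B : V -> Prop) (v : V) :
    Prop :=
  exists (s : seq V) (c : V -> F),
    (forall u, u \in s -> B u) /\ v = \sum_(u <- s) c u *: u.

Definition is_basis (F : fieldType) (V : lmodType F) (B W : V -> Prop) : Prop :=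
  lin_indep B /\ forall v, W v <-> lin_span B v.

(* Main.v *)
Require Import Defs.
From HB Require Import structures.
From mathcomp Require Import all_boot all_order all_algebra.
From mathcomp Require Import boolp functions finmap monalg zify.

Set Implicit Arguments.
Unset Strict Implicit.
Unset Printing Implicit Defensive.

Import Order.TTheory GRing.Theory.

(** Call r the order of the symbol x^(r).  By Leibniz's rule, [tau t] is a sum
    of products of symbols ([tau_words]).  In each of them the last factor has
    order 0 and the weight is -1 ([admissible_words]), and such a product is
    determined by its last factor and by the multiset of the other ones
    ([mono_perm]).  The theorem says that the family tau [a], for a in P(X), is
    unitriangular with respect to these products.

    Triangularity.  Each operation that builds [a] applies d to a product of
    symbols.  If the derivative always hits the first factor, the product that
    comes out is a itself, and this happens for one term only.  In any other
    term some derivatives have moved to the right, so that its sequence p of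
    orders has smaller partial sums than the sequence r of orders of a, with the
    same total, while positive orders stay positive ([leads_phi]).  If p has as
    many zeros as r, then, the positive part of r being nondecreasing, summation
    by parts gives sum r_i p_i >= sum r_i^2 ([dot_abel]), whence
    sum p_i^2 > sum r_i^2.  So every other term has either fewer factors of order
    0, or as many of them and a larger sum of squares of the orders.  The number
    [potential] encodes this comparison, and it only depends on the multiset of
    the orders: tau [a] is a plus products of larger potential ([words_phi]).

    Generation.  The potential is bounded for a given number of factors, so
    every product of weight -1 whose last factor has order 0 is, by induction, a
    combination of elements tau [a] ([admissible_span]).

    Independence.  In a linear relation, the coordinate along a product a of
    smallest potential isolates the coefficient of tau [a].  That such a
    coordinate exists on a free algebra ([coordinate]) is seen by mapping it to a
    concrete one.  Sequences in a perm algebra B form a perm algebra, with the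
    shift as derivation and with the product that Leibniz's rule dictates; this
    works in every characteristic.  The zeroth term is multiplicative and sends
    d^k(x) to the k-th term of x, so the symbols can be given arbitrary values in
    B.  For B one takes pairs of polynomials, the second of which remembers the
    last factor of a product. *)

(** * Products of symbols and Leibniz's rule *)

Section Bilinearity.
Local Open Scope ring_scope.
Variables (F : fieldType) (D : derPermAlgType F).

Lemma pmul0l (a : D) : pmul 0 a = 0.
Proof. by rewrite -(scale0r a) pmulZl !scale0r. Qed.

Lemma pmul0r (a : D) : pmul a 0 = 0.
Proof. by rewrite -(scale0r a) pmulZr !scale0r. Qed.

Lemma der0 : der (0 : D) = 0.
Proof. by rewrite -(scale0r (0 : D)) derZ !scale0r. Qed.

Lemma pmul_suml (I : Type) (r : seq I) (G : I -> D) b :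
  pmul (\sum_(i <- r) G i) b = \sum_(i <- r) pmul (G i) b.
Proof.
by apply: (big_morph (pmul^~ b)); [move=> x y; exact: pmulDl | exact: pmul0l].
Qed.

Lemma pmul_sumr (I : Type) (r : seq I) (G : I -> D) b :
  pmul b (\sum_(i <- r) G i) = \sum_(i <- r) pmul b (G i).
Proof.
by apply: (big_morph (pmul b)); [move=> x y; exact: pmulDr | exact: pmul0r].
Qed.

Lemma der_sum (I : Type) (r : seq I) (G : I -> D) :
  der (\sum_(i <- r) G i) = \sum_(i <- r) der (G i).
Proof. by apply: (big_morph der); [exact: derD | exact: der0]. Qed.

End Bilinearity.

Section Monomials.
Local Open Scope ring_scope.
Variables (F : fieldType) (X : Type) (D : derPermAlgType F) (iota : X -> D).

Definition symb_val (s : symb X) : D := iter s.2 der (iota s.1).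

(** A perm algebra need not have a unit; the value 0 at the empty word is a
    convention that keeps [der_mono] true there. *)
Fixpoint mono (w : seq (symb X)) : D :=
  match w with
  | [::] => 0
  | s :: w' => if w' is [::] then symb_val s else pmul (symb_val s) (mono w')
  end.

(** The terms of the derivative of a word. *)
Fixpoint bumps (w : seq (symb X)) : seq (seq (symb X)) :=
  if w is s :: w' then
    ((s.1, s.2.+1) :: w') :: [seq s :: v | v <- bumps w']
  else [::].

(** The terms of the expansion of [tau t], with multiplicity. *)
Fixpoint words (t : magma X) : seq (seq (symb X)) :=
  match t with
  | Leaf x => [:: [:: (x, 0%N)]]
  | Node a b =>
    [seq u ++ v | u <- flatten [seq bumps w | w <- words a], v <- words b]
  end.

Lemma mono_cons2 s t w : mono [:: s, t & w] = pmul (symb_val s) (mono (t :: w)).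
Proof. by []. Qed.

Lemma mono_rcons u z :
  mono (rcons u z)
  = foldr (fun s a => pmul (symb_val s) a) (symb_val z) u.
Proof. by elim: u => //= s [|t u] IHu //; rewrite -IHu. Qed.

Lemma mono_cat u v : (0 < size u)%N -> (0 < size v)%N ->
  mono (u ++ v) = pmul (mono u) (mono v).
Proof.
move=> + v0; elim: u => [|s [|t u] IHu] // _; first by case: v v0 {IHu}.
by rewrite /= in IHu *; rewrite IHu // pmulA.
Qed.

Lemma der_mono w : der (mono w) = \sum_(v <- bumps w) mono v.
Proof.
elim: w => [|s [|t w] IHw]; first by rewrite big_nil der0.
  by rewrite /= big_seq1.
rewrite mono_cons2 derM IHw [bumps (s :: _)]/= [bumps (t :: w)]/=.
rewrite -map_comp !big_cons !big_map pmulDr pmul_sumr.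
by congr (_ + (_ + _)).
Qed.

End Monomials.

Section Words.
Variable X : eqType.
Implicit Types (w u v : seq (symb X)) (x : X) (t : magma X).

Definition orders w := [seq s.2 | s <- w].

Lemma size_bumps w v : v \in bumps w -> size v = size w.
Proof.
elim: w v => //= s w IHw v.
by rewrite inE => /predU1P[-> //|/mapP[v' /IHw <- ->]].
Qed.

Lemma sumn_bumps w v :
  v \in bumps w -> sumn (orders v) = (sumn (orders w)).+1.
Proof.
elim: w v => //= s w IHw v; rewrite inE => /predU1P[-> //|/mapP[v' /IHw E ->]].
by rewrite /= E addnS.
Qed.

(** These are the words of weight -1 whose last factor has order 0: see
    [wt_balanced] for the weight. *)
Definition admissible w : Prop :=
  exists u x, w = rcons u (x, 0) /\ sumn (orders u) = size u.

(** The derivative of an admissible word has weight 0, and the product with a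
    second admissible word restores the weight -1 and a last factor of order 0. *)
Lemma admissible_words t v : v \in words t -> admissible v.
Proof.
elim: t v => [x|a IHa b IHb] v /=.
  by rewrite inE => /eqP->; exists [::], x.
case/allpairsP=> -[u1 u2] /=.
case=> /flattenP[l /mapP[w /IHa[w0 [x [-> Ew]]] ->]] Hu1.
move=> /IHb[u [y [-> Eu]]] ->.
exists (u1 ++ u), y; split; first by rewrite rcons_cat.
rewrite /orders map_cat sumn_cat size_cat -/(orders _) -/(orders _) Eu.
rewrite (sumn_bumps Hu1) (size_bumps Hu1) size_rcons /orders map_rcons.
by rewrite sumn_rcons addn0 -/(orders _) Ew.
Qed.

Section Value.
Local Open Scope ring_scope.
Variables (F : fieldType) (D : derPermAlgType F) (iota : X -> D).

Lemma tau_words t : tau iota t = \sum_(v <- words t) mono iota v.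
Proof.
elim: t => [x|a IHa b IHb] /=; first by rewrite big_seq1.
rewrite /succ_op IHa IHb der_sum pmul_suml big_allpairs_dep big_flatten /=.
rewrite big_map big_seq_cond [RHS]big_seq_cond.
apply: eq_bigr => w /andP[/admissible_words wA _].
rewrite der_mono pmul_suml big_seq_cond [RHS]big_seq_cond.
apply: eq_bigr => u /andP[uB _].
rewrite pmul_sumr big_seq_cond [RHS]big_seq_cond.
apply: eq_bigr => v /andP[/admissible_words vA _]; rewrite mono_cat //.
  by rewrite (size_bumps uB); case: wA => ? [? [-> _]]; rewrite size_rcons.
by case: vA => ? [? [-> _]]; rewrite size_rcons.
Qed.

Lemma mono_perm u v z :
  perm_eq u v -> mono iota (rcons u z) = mono iota (rcons v z).
Proof.
rewrite !mono_rcons; apply/catCA_perm_subst: u v => s1 s2 s3.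
rewrite !foldr_cat; set a := foldr _ _ s3.
pose act s b := pmul (symb_val iota s) b.
have actC s b u : foldr act (act s b) u = act s (foldr act b u).
  by elim: u => //= t u ->; rewrite /act !pmulA pmul_perm.
by elim: s2 => //= s u <-; rewrite [LHS]actC.
Qed.

End Value.
End Words.

(** * A perm algebra with derivation where the products are independent *)

Section Marked.
Local Open Scope ring_scope.
Variables (F : fieldType) (C : comAlgType F).

(** Only the second component distinguishes the last factor of a product from
    the other ones. *)
Definition marked : Type := (C * C)%type.
HB.instance Definition _ := GRing.Lmodule.on marked.

Definition marked_mul (a b : marked) : marked := (a.1 * b.1, a.1 * b.2).

Lemma marked_mulDl : left_distributive marked_mul +%R.
Proof. by move=> a b c; congr (_, _); rewrite /= mulrDl. Qed.

Lemma marked_mulDr : right_distributive marked_mul +%R.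
Proof. by move=> a b c; congr (_, _); rewrite /= mulrDr. Qed.

Lemma marked_mulZl (c : F) a b : marked_mul (c *: a) b = c *: marked_mul a b.
Proof. by congr (_, _); rewrite /= scalerAl. Qed.

Lemma marked_mulZr (c : F) a b : marked_mul a (c *: b) = c *: marked_mul a b.
Proof. by congr (_, _); rewrite /= scalerAr. Qed.

Lemma marked_mulA : associative marked_mul.
Proof. by move=> a b c; congr (_, _); rewrite /= mulrA. Qed.

Lemma marked_mul_perm a b c :
  marked_mul (marked_mul a b) c = marked_mul (marked_mul b a) c.
Proof. by congr (_, _); rewrite /= (mulrC a.1). Qed.

HB.instance Definition _ := Lmodule_isPermAlg.Build F marked
  marked_mulDl marked_mulDr marked_mulZl marked_mulZr marked_mulA
  marked_mul_perm.

End Marked.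

Section Hurwitz.
Local Open Scope ring_scope.
Variables (F : fieldType) (B : permAlgType F).

Definition hurwitz : Type := nat -> B.
HB.instance Definition _ := GRing.Lmodule.on hurwitz.

Definition shift (f : hurwitz) : hurwitz := fun n => f n.+1.

(** This is the Hurwitz product, whose n-th term is the sum of the
    C(n, k) f_k g_(n-k).  The recursion on n avoids the binomial coefficients: it
    makes Leibniz's rule hold by definition, and every identity between products
    follows by induction on n from the same identity in B. *)
Fixpoint hmul_at n (f g : hurwitz) : B :=
  if n is n'.+1 then hmul_at n' (shift f) g + hmul_at n' f (shift g)
  else pmul (f 0) (g 0).

Definition hmul (f g : hurwitz) : hurwitz := fun n => hmul_at n f g.

Lemma shiftD f g : shift (f + g) = shift f + shift g.
Proof. by []. Qed.

Lemma shiftZ (c : F) f : shift (c *: f) = c *: shift f.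
Proof. by []. Qed.

Lemma shiftM f g : shift (hmul f g) = hmul (shift f) g + hmul f (shift g).
Proof. by []. Qed.

Lemma hurwitz_addE (f g : hurwitz) n : (f + g) n = f n + g n.
Proof. by []. Qed.

Lemma hmulDl : left_distributive hmul +%R.
Proof.
move=> f g h; apply/funext=> n.
elim: n f g h => [|n IHn] f g h; first exact: pmulDl.
have /= E := IHn; rewrite /hmul /= shiftD in E *.
by rewrite [hmul_at n (_ + _) h]E [hmul_at n (_ + _) _]E addrACA.
Qed.

Lemma hmulDr : right_distributive hmul +%R.
Proof.
move=> f g h; apply/funext=> n.
elim: n f g h => [|n IHn] f g h; first exact: pmulDr.
have /= E := IHn; rewrite /hmul /= shiftD in E *.
by rewrite [hmul_at n _ (g + h)]E [hmul_at n f _]E addrACA.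
Qed.

Lemma hmulZl (c : F) f g : hmul (c *: f) g = c *: hmul f g.
Proof.
apply/funext=> n; elim: n f g => [|n IHn] f g; first exact: pmulZl.
have /= E := IHn; rewrite /hmul /= shiftZ in E *.
by rewrite !E -scalerDr.
Qed.

Lemma hmulZr (c : F) f g : hmul f (c *: g) = c *: hmul f g.
Proof.
apply/funext=> n; elim: n f g => [|n IHn] f g; first exact: pmulZr.
have /= E := IHn; rewrite /hmul /= shiftZ in E *.
by rewrite !E -scalerDr.
Qed.

Lemma hmulA : associative hmul.
Proof.
move=> f g h; apply/funext=> n.
elim: n f g h => [|n IHn] f g h; first exact: pmulA.
rewrite -[LHS]/(shift (hmul f (hmul g h)) n).
rewrite -[RHS]/(shift (hmul (hmul f g) h) n).
rewrite !shiftM hmulDl hmulDr.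
have E a b c : hmul a (hmul b c) n = hmul (hmul a b) c n by exact: IHn.
by rewrite !hurwitz_addE !E addrA.
Qed.

Lemma hmul_perm f g h : hmul (hmul f g) h = hmul (hmul g f) h.
Proof.
apply/funext=> n; elim: n f g h => [|n IHn] f g h; first exact: pmul_perm.
rewrite -[LHS]/(shift (hmul (hmul f g) h) n).
rewrite -[RHS]/(shift (hmul (hmul g f) h) n).
rewrite !shiftM !hmulDl !hurwitz_addE (IHn f g) (IHn (shift f)) (IHn f).
by congr (_ + _); exact: addrC.
Qed.

HB.instance Definition _ := Lmodule_isPermAlg.Build F hurwitz
  hmulDl hmulDr hmulZl hmulZr hmulA hmul_perm.
HB.instance Definition _ := PermAlg_hasDer.Build F hurwitz
  shiftD shiftZ shiftM.

Lemma hurwitz_der n (f : hurwitz) : iter n der f 0 = f n.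
Proof.
have H m k : iter m der f k = f (m + k)%N.
  elim: m k => //= m IHm k; rewrite -[LHS]/(iter m der f k.+1) IHm.
  by rewrite addnS.
by rewrite H addn0.
Qed.

Lemma hurwitz_mul0 (f g : hurwitz) : pmul f g 0 = pmul (f 0) (g 0).
Proof. by []. Qed.

End Hurwitz.

Section Coordinates.
Local Open Scope ring_scope.
Variables (F : fieldType) (X : choiceType).

(** Two copies of the set of symbols: the right one is used for the last factor
    of a product. *)
Definition mark := (symb X + symb X)%type.
Local Notation C := {malg F[{cmonom mark}]}.

Definition generic (x : X) : hurwitz (marked C) := fun n =>
  (<< ucm (inl (x, n) : mark) >>, << ucm (inr (x, n) : mark) >>).

Definition word_monom (u : seq (symb X)) (z : symb X) : {cmonom mark} :=
  foldr (fun s m => mmul (ucm (inl s : mark)) m) (ucm (inr z : mark)) u.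

Lemma word_monom_inj u v z t : word_monom u z = word_monom v t ->
  perm_eq u v /\ z = t.
Proof.
have El s w y : word_monom w y (inl s) = count_mem s w.
  elim: w => [|r w IHw] /=; first by rewrite cmU.
  by rewrite cmM cmU IHw.
have Er s w y : word_monom w y (inr s) = (y == s).
  elim: w => [|r w IHw] /=; first by rewrite cmU.
  by rewrite cmM cmU IHw.
move=> E; split; last first.
  have := Er t u z; rewrite E Er eqxx.
  by case: eqVneq.
by apply/allP => s _ /=; rewrite -(El s u z) E El.
Qed.

Lemma word_monom_perm u v z : perm_eq u v -> word_monom u z = word_monom v z.
Proof.
move=> E; apply/eqP/cmP => i.
apply/catCA_perm_subst: u v E => s1 s2 s3.
rewrite /word_monom !foldr_cat; set m := foldr _ _ s3.
pose act (s : symb X) m1 := mmul (ucm (inl s : mark)) m1.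
have H w (m1 : {cmonom mark}) :
    foldr act m1 w = mmul (foldr act (@mone {cmonom mark}) w) m1.
  by elim: w => /= [|s w ->]; rewrite /act ?mul1m ?mulmA.
rewrite [in LHS](H s1) [in RHS](H s2) [in LHS](H s2) [in RHS](H s1).
by rewrite !mulmA (mulmC (foldr _ _ s1)).
Qed.

Lemma generic_mono u z :
  mono generic (rcons u z) 0%N =
  (\prod_(s <- u) << ucm (inl s : mark) >> * << ucm (inl z : mark) >>,
   << word_monom u z >>).
Proof.
have V s : symb_val generic s 0%N
    = (<< ucm (inl s : mark) >>, << ucm (inr s : mark) >>).
  by case: s => x n; rewrite /symb_val hurwitz_der.
rewrite mono_rcons.
elim: u => [|s u IHu]; first by rewrite big_nil mul1r [foldr _ _ _]/= V.
rewrite big_cons -mulrA [foldr _ _ _]/= hurwitz_mul0 V IHu.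
congr (_, _).
by rewrite [LHS]malgM_def [LHS]fgmulUU mulr1.
Qed.

Variables (D : derPermAlgType F) (iota : X -> D).
Hypothesis hfree : is_free_derperm iota.

(** The morphism to the concrete algebra that sends each x to [generic x], then
    the zeroth term, then the coefficient of one monomial in the second
    component. *)
Lemma coordinate (u : seq (symb X)) (x : X) :
  exists kappa : {scalar D}, forall v y,
    kappa (mono iota (rcons v (y, 0%N))) = (perm_eq u v && (x == y))%:R.
Proof.
have [[f [[fM fd] fx]] _] := hfree generic.
have fmono v : f (mono iota v) = mono generic v.
  have fs s : f (symb_val iota s) = symb_val generic s.
    rewrite /symb_val -fx; elim: s.2 => //= n <-.
    by rewrite fd.
  elim: v => [|s [|t v] IHv]; first exact: linear0.
    exact: fs.
  by rewrite mono_cons2 fM fs IHv.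
pose kappa d := mcoeff (word_monom u (x, 0%N)) (f d 0%N).2.
have kappa_lin : scalar kappa.
  move=> c a b; rewrite /kappa linearP.
  by rewrite -mcoeffZ -mcoeffD.
pose kappaL : {scalar D} :=
  HB.pack kappa (GRing.isLinear.Build F D F _ kappa kappa_lin).
exists kappaL => v y; rewrite /= /kappa fmono generic_mono [_.2]/= mcoeffU1.
congr (nat_of_bool _)%:R.
apply/eqP/andP => [/word_monom_inj[uv [->]]|[uv /eqP->]].
  by rewrite perm_sym.
by apply: word_monom_perm; rewrite perm_sym.
Qed.

End Coordinates.

(** * Sequences of orders with smaller partial sums *)

Section Dominance.
Implicit Types (p r : seq nat) (c m : nat).

(** Each partial sum of p is at most c plus the corresponding one of r, and p is
    positive wherever r is.  The slack c makes the recursion possible: it counts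
    the units that have been taken from the left and not yet put back. *)
Fixpoint dominated c p r : bool :=
  match p, r with
  | [::], [::] => true
  | x :: p', y :: r' =>
    [&& x <= c + y, (0 < y) ==> (0 < x) & dominated (c + y - x) p' r']
  | _, _ => false
  end.

Lemma dominated_leq c c' p r : c <= c' -> dominated c p r -> dominated c' p r.
Proof.
elim: p r c c' => [|x p IHp] [|y r] c c' //= le_c.
case/and3P=> [? -> /(IHp _ _ _)->].
  by rewrite andbT /=; lia.
lia.
Qed.

Lemma dominated_refl p : dominated 0 p p.
Proof. by elim: p => //= x p IHp; rewrite leqnn implybb add0n subnn. Qed.

Lemma dominated_size c p r : dominated c p r -> size p = size r.
Proof. by elim: p r c => [|x p IHp] [|y r] c //= /and3P[_ _ /IHp->]. Qed.

Lemma dominated_rcons0 c p r :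
  dominated c p r -> dominated c (rcons p 0) (rcons r 0).
Proof. by elim: p r c => [|x p IHp] [|y r] c //= /and3P[-> -> /IHp->]. Qed.

Definition npos p := count (fun x => 0 < x) p.

Lemma dominated_npos c p r : dominated c p r -> npos r <= npos p.
Proof.
elim: p r c => [|x p IHp] [|y r] c //= /and3P[_ pos /IHp le].
by apply: leq_add => //; case: (0 < y) pos => //= ->.
Qed.

Fixpoint dot p r :=
  match p, r with
  | x :: p', y :: r' => x * y + dot p' r'
  | _, _ => 0
  end.

(** Summation by parts.  The units that p lacks with respect to r on the left
    reappear further to the right, where r is larger, so that the product with r
    can only grow; the c units of slack come in where r is at least m.  As p and
    r have as many positive entries, none reappears where r is zero. *)
Lemma dot_abel c m p r k :
  dominated c p (r ++ nseq k 0) -> 0 < m -> path leq m r ->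
  npos p = npos (r ++ nseq k 0) -> sumn p = c + sumn (r ++ nseq k 0) ->
  dot (r ++ nseq k 0) (r ++ nseq k 0) + m * c <= dot (r ++ nseq k 0) p.
Proof.
elim: r p c m => [|y r IHr] p c m /=.
  move=> dp m_gt0 _ np sp.
  have d0 q : dot (nseq k 0) q = 0.
    by elim: (k) q => [|k' IHk] [|x q] //=; exact: IHk.
  suff -> : c = 0 by rewrite muln0 addn0 !d0.
  have n0 : npos (nseq k 0) = 0 by rewrite /npos count_nseq.
  have s0 : sumn p = 0.
    rewrite n0 in np; move/eqP: np {dp sp}.
    rewrite -leqn0 leqNgt -has_count => np.
    by elim: p np => //= x p IHp; rewrite negb_or -eqn0Ngt => /andP[/eqP-> /IHp].
  lia.
case: p => [|x p] //= /and3P[le_x pos dp] m_gt0 /andP[le_my pr] np sp.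
have y_gt0 : 0 < y by lia.
have x_gt0 : 0 < x by rewrite y_gt0 in pos.
have {}np : npos p = npos (r ++ nseq k 0) by rewrite y_gt0 x_gt0 /= in np; lia.
have := IHr _ _ _ dp y_gt0 pr np ltac:(lia).
nia.
Qed.

Lemma dot_sqr p r :
  size p = size r -> 2 * dot r p + (p != r) <= dot p p + dot r r.
Proof.
elim: p r => [|x p IHp] [|y r] //= [/IHp]; rewrite eqseq_cons negb_and.
case: (eqVneq x y) => [->|neq] /=; first by lia.
case: (p != r) => /=; nia.
Qed.

Lemma dot_le p : dot p p <= sumn p ^ 2.
Proof. elim: p => //= x p; nia. Qed.

(** The lexicographic pair of the number of positive entries and of the sum of
    squares, as one number: in the sequences that matter the sum is smaller than
    the size, hence the sum of squares smaller than the squared size. *)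
Definition potential p := npos p * size p ^ 2 + dot p p.

Lemma potential_bound p :
  sumn p < size p -> potential p <= size p ^ 3 + size p ^ 2.
Proof.
move=> lt_p; have := dot_le p; have := count_size (fun x => 0 < x) p.
rewrite /potential -/(npos p) => le1 le2; nia.
Qed.

Lemma potential_lt p r k :
  dominated 0 p (r ++ nseq k 0) -> p != r ++ nseq k 0 ->
  all (fun x => 0 < x) r -> sorted leq r ->
  sumn p = sumn (r ++ nseq k 0) -> sumn p < size p ->
  potential (r ++ nseq k 0) < potential p.
Proof.
move=> dp neq pos srt eqs lts; rewrite /potential -(dominated_size dp).
have := dot_le (r ++ nseq k 0); rewrite -eqs => le1.
have := dominated_npos dp; rewrite leq_eqVlt => /predU1P[eqn|lt_n]; last by nia.
rewrite eqn ltn_add2l.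
have := dot_sqr (dominated_size dp); rewrite neq.
have /= := @dot_abel 0 1 p r k dp isT _ (esym eqn) eqs.
have -> : path leq 1 r by case: (r) pos srt => //= x r' /andP[-> _].
by move/(_ isT); lia.
Qed.

End Dominance.

(** * The leading term of a nonassociative word *)

Section Leading.
Variable X : eqType.
Implicit Types (w u v L : seq (symb X)) (x : X) (t : magma X).

Lemma dominated_bump c w v r :
  v \in bumps w -> dominated c (orders w) r -> dominated c.+1 (orders v) r.
Proof.
elim: w v c r => //= s w IHw v c [|y r] //.
rewrite inE => /predU1P[->|/mapP[v' v'P ->]] /= /and3P[le pos dw].
  rewrite implybT; apply/andP; split; first by lia.
  by apply: dominated_leq dw; lia.
rewrite pos; apply/andP; split; first by lia.
by rewrite addSn subSn //; apply: IHw.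
Qed.

(** The product L has coefficient 1 in [tau t], and every other term differs from
    it by derivatives that have moved to the right. *)
Definition leads t L := exists2 rest, perm_eq (words t) (L :: rest) &
  {in rest, forall v,
    dominated 0 (orders v) (orders L) && (orders v != orders L)}.

Lemma leads_leaf x : leads (Leaf x) [:: (x, 0)].
Proof. by exists [::]. Qed.

Lemma leads_prime x t L : leads t L -> leads (Node (Leaf x) t) ((x, 1) :: L).
Proof.
case=> rest pr dr; exists [seq (x, 1) :: v | v <- rest].
  by rewrite /= cats0 -map_cons; apply: perm_map.
move=> _ /mapP[v /dr /andP[dv neq] ->] /=.
by rewrite dv eqseq_cons negb_and neq orbT.
Qed.

(** The new leading term differentiates the first factor of the old one.  It does
    not arise in another way: the first factor of any other term has at most the
    order p, so that after differentiation the order p.+1 is only reached from a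
    term that begins with the order p and differs from L further on.  The
    condition 0 < p keeps the positive orders positive. *)
Lemma leads_bump x p z t L : 0 < p -> leads t ((x, p) :: L) ->
  leads (Node t (Leaf z)) (rcons ((x, p.+1) :: L) (z, 0)).
Proof.
move=> p_gt0 [rest pr dr].
exists [seq rcons u (z, 0) | u <- [seq (x, p) :: v | v <- bumps L]
                                   ++ flatten [seq bumps v | v <- rest]].
  have -> : words (Node t (Leaf z)) =
      [seq rcons u (z, 0) | u <- flatten [seq bumps w | w <- words t]].
    rewrite /=; elim: (flatten [seq bumps w | w <- words t]) => //= u us ->.
    by rewrite cats1.
  exact: (perm_map (fun u => rcons u (z, 0))
                   (perm_flatten (perm_map (@bumps X) pr))).
move=> _ /mapP[u uP ->].
suff: dominated 0 (orders u) (p.+1 :: orders L)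
      && (orders u != p.+1 :: orders L).
  case/andP=> du neq; rewrite /orders !map_rcons dominated_rcons0 //=.
  by rewrite -rcons_cons eqseq_rcons eqxx andbT.
move: uP; rewrite mem_cat.
case/orP=> [/mapP[v vP ->]|/flattenP[_ /mapP[w wP ->] uP]] /=.
  rewrite leqnSn p_gt0 /= eqseq_cons negb_and neq_ltn ltnSn andbT.
  have := dominated_bump vP (dominated_refl (orders L)).
  by rewrite add0n subSnn.
have /andP[dw neq] := dr _ wP.
case: w dw neq uP {wP} => [|s w] //=; rewrite !add0n => /and3P[le pos dw] neq.
rewrite p_gt0 /= in pos.
rewrite inE => /predU1P[->|/mapP[v vP ->]] /=.
  by rewrite ltnS le subSS dw /= eqseq_cons eqSS.
rewrite pos (leqW le) eqseq_cons negb_and neq_ltn ltnS le /= andbT.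
by rewrite add0n subSn //; apply: dominated_bump vP dw.
Qed.

Definition zeros (ys : seq X) : seq (symb X) := [seq (y, 0) | y <- ys].

Lemma leads_foldl x p (zs : seq X) t L : 0 < p -> leads t ((x, p) :: L) ->
  leads (foldl (@Node X) t (map (@Leaf X) zs))
        ((x, p + size zs) :: L ++ zeros zs).
Proof.
elim: zs t p L => [|z zs IHzs] t p L p_gt0 tL; first by rewrite addn0 cats0.
rewrite /= -cat_rcons addnS -addSn; apply: IHzs => //.
exact: leads_bump.
Qed.

(** A step for x^(r) consumes r entries and puts one back, so it shortens the list
    by r - 1. *)
Definition excess (j : seq (symb X)) := sumn [seq s.2.-1 | s <- j].

(** The entry in front contains every symbol handled so far; the other entries
    are still leaves.  This also covers the initial list, whose first leaf is its
    own leading term. *)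
Lemma foldr_nf_step j (ys : seq X) :
  all (fun s => 0 < s.2) j -> excess j < size ys ->
  exists2 Q, foldr (@nf_step X) (map (@Leaf X) ys) j
               = Q :: map (@Leaf X) (drop (excess j).+1 ys)
    & leads Q (j ++ zeros (take (excess j).+1 ys)).
Proof.
elim: j => [|[x r] j IHj].
  case: ys => // y ys; exists (Leaf y); rewrite /= ?drop0 ?take0 //.
  exact: leads_leaf.
rewrite /excess /= -/(excess j) => /andP[r_gt0 pos] lt.
have [|Q -> lQ] := IHj pos; first by lia.
set zs := drop _ ys; case: r r_gt0 lt => // r _ lt.
exists (foldl (@Node X) (Node (Leaf x) Q) (map (@Leaf X) (take r zs))).
  by rewrite /nf_step /= -map_take -map_drop drop_drop addnS.
have := leads_foldl (take r zs) (ltn0Sn 0) (leads_prime x lQ).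
rewrite add1n size_takel; last by rewrite size_drop; lia.
rewrite -catA /zeros -map_cat -takeD addnC.
by rewrite addnS.
Qed.

Definition nf_prefix (a : nform X) :=
  [seq (x, 1) | x <- nf_k a] ++ nf_j a ++ zeros (nf_i a).

Lemma nf_wordE a : nf_word a = rcons (nf_prefix a) (nf_last a, 0).
Proof. by rewrite /nf_word /nf_prefix map_rcons !rcons_cat. Qed.

Lemma wt_balanced (u : seq (symb X)) x :
  (wt (rcons u (x, 0)) == -1)%R = (sumn (orders u) == size u).
Proof.
have -> : wt (rcons u (x, 0)) = ((sumn (orders u))%:Z - (size u)%:Z - 1)%R.
  rewrite /wt -cats1 big_cat big_seq1 /=.
  by elim: u => [|s u IHu]; rewrite ?big_nil ?big_cons /=; lia.
lia.
Qed.

Lemma leads_phi (a : nform X) : all (fun s => 2 <= s.2) (nf_j a) ->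
  sumn (orders (nf_prefix a)) = size (nf_prefix a) ->
  leads (phi a) (nf_word a).
Proof.
case: a => k j i x /= j2; rewrite /nf_prefix /= => bal.
(* The list has one entry more than [i], so one entry is left at the end. *)
have {}bal : excess j = size i.
  rewrite /orders !map_cat !sumn_cat !size_cat !size_map -!map_comp in bal.
  have e1 (l : seq X) : sumn [seq (snd \o (pair^~ 1)) y | y <- l] = size l.
    by elim: l => //= ? l ->.
  have e0 (l : seq X) : sumn [seq (snd \o (pair^~ 0)) y | y <- l] = 0.
    by elim: l => //= ? l ->.
  rewrite e1 e0 in bal.
  suff E : sumn [seq s.2 | s <- j] = excess j + size j.
    by move/addnI: bal; rewrite addn0 E addnC => /addnI.
  elim: (j) j2 => //= s l IHl /andP[s2 /IHl ->]; rewrite /excess /=; lia.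
rewrite /phi /nf_word /= -map_rcons.
have [||Q -> lQ] := @foldr_nf_step j (rcons i x); rewrite ?bal ?size_rcons //.
  by apply: sub_all j2 => s; lia.
rewrite bal take_oversize ?size_rcons // in lQ.
elim: k => //= y k IHk; exact: leads_prime.
Qed.

End Leading.

(** * Normal forms and their potential *)

Section NormalForms.
Context {disp : Order.disp_t} {X : orderType disp}.
Implicit Types (a b : nform X) (u v w : seq (symb X)).

Definition normal a := [&& all (fun s => 2 <= s.2) (nf_j a),
  sorted (fun x y => (x <= y)%O) (nf_k a), sorted (@symb_le _ X) (nf_j a) &
  sorted (fun x y => (y <= x)%O) (nf_i a)].

Lemma inPE a :
  inP a = normal a && (sumn (orders (nf_prefix a)) == size (nf_prefix a)).
Proof. by rewrite /inP /normal nf_wordE wt_balanced -!andbA. Qed.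

Lemma symb_le_total : total (@symb_le _ X).
Proof.
move=> [x r] [y s]; rewrite /symb_le /=.
by case: ltngtP => //= _; exact: le_total.
Qed.

Lemma symb_le_trans : transitive (@symb_le _ X).
Proof.
move=> [y s] [x r] [z t]; rewrite /symb_le /=.
case: (ltngtP r s) => //= [lt|->] le1.
  case/orP=> [lt2|/andP[/eqP<- _]]; last by rewrite lt.
  by rewrite (ltn_trans lt lt2).
case: ltngtP => //= _; exact: le_trans.
Qed.

Lemma symb_le_anti : antisymmetric (@symb_le _ X).
Proof.
move=> [x r] [y s]; rewrite /symb_le /=.
by case: ltngtP => //= -> /le_anti ->.
Qed.

Lemma filter_prefix a : all (fun s => 2 <= s.2) (nf_j a) ->
  [/\ [seq s <- nf_prefix a | s.2 == 1] = [seq (x, 1) | x <- nf_k a],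
      [seq s <- nf_prefix a | 2 <= s.2] = nf_j a
    & [seq s <- nf_prefix a | s.2 == 0] = zeros (nf_i a)].
Proof.
have keep n (P : pred nat) (l : seq X) : P n ->
    [seq s <- [seq (x, n) | x <- l] | P s.2] = [seq (x, n) | x <- l].
  by move=> Pn; apply/all_filterP; rewrite all_map; apply/allP.
have kill n (P : pred nat) (l : seq X) : ~~ P n ->
    [seq s <- [seq (x, n) | x <- l] | P s.2] = [::].
  by move=> Pn; elim: l => //= x l ->; rewrite (negbTE Pn).
move=> j2.
have killj (P : pred nat) : (forall n, 2 <= n -> ~~ P n) ->
    [seq s <- nf_j a | P s.2] = [::].
  by move=> HP; elim: (nf_j a) j2 => //= s l IHl /andP[/HP/negbTE-> /IHl].
rewrite /nf_prefix /zeros !filter_cat; split.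
- rewrite (keep 1 (fun n => n == 1)) // (killj (fun n => n == 1)).
    by rewrite (kill 0 (fun n => n == 1)) ?cats0.
  by case=> [|[]].
- rewrite (kill 1 (fun n => 2 <= n)) // (kill 0 (fun n => 2 <= n)) // cats0.
  exact/all_filterP.
- rewrite (kill 1 (fun n => n == 0)) // (killj (fun n => n == 0)) //.
    by rewrite (keep 0 (fun n => n == 0)).
  by case.
Qed.

Lemma normal_inj a b : normal a -> normal b ->
  perm_eq (nf_prefix a) (nf_prefix b) -> nf_last a = nf_last b -> a = b.
Proof.
case/and4P=> /filter_prefix[ka ja ia] ska sja sia.
case/and4P=> /filter_prefix[kb jb ib] skb sjb sib pab lab.
have K : nf_k a = nf_k b.
  apply: (sorted_eq le_trans le_anti) => //.
  apply: (@perm_map_inj _ _ (fun x => (x, 1))); first by move=> ? ? [].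
  by rewrite -ka -kb; apply: perm_filter.
have J : nf_j a = nf_j b.
  apply: (sorted_eq symb_le_trans symb_le_anti) => //.
  by rewrite -ja -jb; apply: perm_filter.
have I : nf_i a = nf_i b.
  apply: (sorted_eq ge_trans ge_anti) => //.
  apply: (@perm_map_inj _ _ (fun x => (x, 0))); first by move=> ? ? [].
  by rewrite -/(zeros _) -/(zeros _) -ia -ib; apply: perm_filter.
by case: a b K J I lab {ka ja ia ska sja sia kb jb ib skb sjb sib pab}
  => [? ? ? ?] [? ? ? ?] /= -> -> -> ->.
Qed.

Lemma normal_form u x : exists2 a, normal a &
  perm_eq (nf_prefix a) u /\ nf_last a = x.
Proof.
exists (NForm (sort (fun x y => (x <= y)%O) [seq s.1 | s <- u & s.2 == 1])
   (sort (@symb_le _ X) [seq s <- u | 2 <= s.2])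
   (sort (fun x y => (y <= x)%O) [seq s.1 | s <- u & s.2 == 0]) x).
  apply/and4P; split=> /=; rewrite ?sort_sorted //; try exact: symb_le_total.
  by rewrite all_sort filter_all.
split=> //=; rewrite /nf_prefix /zeros /=.
have E n : [seq (x, n) | x <- [seq s.1 | s <- u & s.2 == n]]
           = [seq s <- u | s.2 == n].
  by elim: u => //= -[y m] l IHl; rewrite /=; case: eqP => //= ->; rewrite IHl.
apply/permP => P; rewrite !count_cat.
rewrite (permP (perm_map _ (permEl (perm_sort _ _)))) E.
rewrite (permP (permEl (perm_sort _ _))).
rewrite (permP (perm_map _ (permEl (perm_sort _ _)))) E.
by elim: u {E} => //= -[y [|[|n]]] l <- /=; lia.
Qed.

Definition word_potential w := potential (orders w).

Lemma word_potential_perm u v :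
  perm_eq u v -> word_potential u = word_potential v.
Proof.
move=> uv; have {}uv : perm_eq (orders u) (orders v) by apply: perm_map.
rewrite /word_potential /potential /npos (perm_size uv) (permP uv).
have E p : dot p p = sumn [seq x * x | x <- p] by elim: p => //= x p ->.
by rewrite !E; congr (_ + _); apply: perm_sumn; apply: perm_map.
Qed.

Lemma nf_orders_sorted a : normal a ->
  sorted leq (nseq (size (nf_k a)) 1 ++ orders (nf_j a)).
Proof.
case/and4P=> j2 _ srt _.
have {srt}srt : sorted leq (orders (nf_j a)).
  rewrite /orders sorted_map; apply: sub_sorted srt => s t.
  by case/orP => [/ltnW //|/andP[/eqP E _]]; rewrite /= E.
have pth : path leq 1 (orders (nf_j a)).
  rewrite path_min_sorted // all_map; apply: sub_all j2 => s /=; lia.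
by case: (size _) => //= n; elim: n => //=.
Qed.

(** Unitriangularity: [leads_phi] read through [potential_lt], which applies
    since the normal form lists the positive orders increasingly before the
    zeros. *)
Lemma words_phi a : inP a -> exists2 rest,
  perm_eq (words (phi a)) (nf_word a :: rest) &
  {in rest, forall v, size v = size (nf_word a) /\
                      word_potential (nf_word a) < word_potential v}.
Proof.
rewrite inPE => /andP[na /eqP bal]; have /and4P[j2 _ _ _] := na.
have [rest pr dr] := leads_phi j2 bal; exists rest => // v vr.
have /andP[dv neq] := dr v vr.
have [u [x [Ev bu]]] : admissible v.
  by apply: (@admissible_words _ (phi a)); rewrite (perm_mem pr) inE vr orbT.
have bv : (sumn (orders v)).+1 = size v.
  by rewrite Ev /orders map_rcons sumn_rcons size_rcons addn0 -/(orders u) bu.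
have ba : (sumn (orders (nf_word a))).+1 = size (nf_word a).
  rewrite nf_wordE /orders map_rcons sumn_rcons size_rcons addn0.
  by rewrite -/(orders _) bal.
have Ea : orders (nf_word a) = (nseq (size (nf_k a)) 1 ++ orders (nf_j a))
   ++ nseq (size (nf_i a)).+1 0.
  rewrite /orders /nf_word !map_cat -!map_comp catA.
  have E n (l : seq X) : [seq (snd \o (pair^~ n)) x | x <- l] = nseq (size l) n.
    by elim: l => //= ? l ->.
  by rewrite !E size_rcons.
have sz := dominated_size dv; rewrite !size_map in sz; split=> //.
rewrite /word_potential Ea; apply: potential_lt; rewrite -?Ea ?size_map //.
- rewrite all_cat all_nseq orbT all_map; apply: sub_all j2 => s /=; lia.
- exact: nf_orders_sorted.
- by apply: succn_inj; rewrite bv ba.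
- by rewrite -bv.
Qed.

End NormalForms.

(** * Linear spans *)

Section Span.
Local Open Scope ring_scope.
Variables (F : fieldType) (V : lmodType F) (B : V -> Prop).

(** A linear span attaches one coefficient to each vector; a list of pairs allows
    repetitions, so that concatenation gives sums. *)
Lemma lin_span_pairs (t : seq (F * V)) : (forall p, p \in t -> B p.2) ->
  lin_span B (\sum_(p <- t) p.1 *: p.2).
Proof.
move=> tB.
exists (undup [seq p.2 | p <- t]), (fun u => \sum_(p <- t | p.2 == u) p.1).
split=> [u|]; first by rewrite mem_undup => /mapP[p /tB Bp ->].
under [RHS]eq_bigr do rewrite scaler_suml big_mkcond.
rewrite exchange_big big_seq [RHS]big_seq; apply: eq_bigr => p pt /=.
rewrite -big_mkcond (eq_bigl (pred1 p.2)) => [|u]; last exact: eq_sym.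
rewrite -big_filter filter_pred1_uniq ?undup_uniq ?big_seq1 //.
by rewrite mem_undup map_f.
Qed.

Lemma lin_span_comb (I : Type) (r : seq I) (c : I -> F) (v : I -> V) :
  (forall i, lin_span B (v i)) -> lin_span B (\sum_(i <- r) c i *: v i).
Proof.
move=> Bv.
suff [t tB ->] : exists2 t : seq (F * V), (forall p, p \in t -> B p.2)
    & \sum_(i <- r) c i *: v i = \sum_(p <- t) p.1 *: p.2.
  exact: lin_span_pairs.
elim: r => [|i r [t tB E]]; first by exists [::]; rewrite ?big_nil.
have [s [k [sB Ev]]] := Bv i.
exists ([seq (c i * k u, u) | u <- s] ++ t).
  by move=> p; rewrite mem_cat => /orP[/mapP[u /sB Bu ->]|/tB].
rewrite big_cons big_cat E big_map Ev scaler_sumr; congr (_ + _).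
by apply: eq_bigr => u _; rewrite scalerA.
Qed.

Lemma lin_span_sum (I : eqType) (r : seq I) (v : I -> V) :
  (forall i, i \in r -> lin_span B (v i)) -> lin_span B (\sum_(i <- r) v i).
Proof.
move=> Bv; rewrite big_seq.
rewrite (eq_bigr (fun i => 1 *: (if i \in r then v i else 0))); last first.
  by move=> i ir; rewrite ir scale1r.
rewrite -big_seq.
apply: lin_span_comb => i; case: ifP => [/Bv //|_].
by exists [::], (fun=> 0); split; rewrite ?big_nil.
Qed.

Lemma lin_spanB u v : lin_span B u -> lin_span B v -> lin_span B (u - v).
Proof.
move=> Bu Bv; rewrite -[u]scale1r -scaleN1r.
have := @lin_span_comb _ [:: true; false] (fun b => if b then 1 else -1)
  (fun b => if b then u else v).
by rewrite big_cons big_seq1; apply; case.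
Qed.

Lemma lin_span_mem v : B v -> lin_span B v.
Proof.
move=> Bv; exists [:: v], (fun=> 1); rewrite big_seq1 scale1r.
by split=> [u|]; rewrite ?inE // => /eqP->.
Qed.

End Span.

(** * Generation and independence *)

Section Basis.
Local Open Scope ring_scope.
Variables (F : fieldType) (disp : Order.disp_t) (X : orderType disp).
Variables (D : derPermAlgType F) (iota : X -> D).
Local Notation tau := (tau iota).
Local Notation basis :=
  (fun v : D => exists2 a : nform X, inP a & v = tau (phi a)).

Lemma succ_subalg_tau v : succ_subalg iota v ->
  exists t : seq (F * magma X), v = \sum_(p <- t) p.1 *: tau p.2.
Proof.
elim=> [x||u w _ [s ->] _ [t ->]|c u _ [s ->]|u w _ [s ->] _ [t ->]].
- by exists [:: (1, Leaf x)]; rewrite big_seq1 scale1r.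
- by exists [::]; rewrite big_nil.
- by exists (s ++ t); rewrite big_cat.
- exists [seq (c * p.1, p.2) | p <- s]; rewrite big_map scaler_sumr.
  by apply: eq_bigr => p _; rewrite scalerA.
- exists [seq (p.1 * q.1, Node p.2 q.2) | p <- s, q <- t].
  rewrite big_allpairs_dep /succ_op der_sum pmul_suml; apply: eq_bigr => p _.
  rewrite pmul_sumr; apply: eq_bigr => q _.
  by rewrite derZ pmulZl pmulZr scalerA.
Qed.

Lemma tau_succ_subalg t : succ_subalg iota (tau t).
Proof. by elim: t => [x|a IHa b IHb]; [exact: Succ_gen | exact: Succ_op]. Qed.

Lemma lin_span_succ_subalg v : lin_span basis v -> succ_subalg iota v.
Proof.
case=> s [c [sB ->]]; elim: s sB => [|u s IHs] sB.
  by rewrite big_nil; exact: Succ_0.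
rewrite big_cons; apply: Succ_add.
  have [a _ ->] := sB u (mem_head _ _).
  exact/Succ_scale/tau_succ_subalg.
by apply: IHs => w ws; apply: sB; rewrite inE ws orbT.
Qed.

(** Descending induction on the potential, which is bounded for words of a given
    length: solve tau [a] = w + (terms of larger potential) for w, where a is the
    normal form of w. *)
Lemma admissible_span w : admissible w -> lin_span basis (mono iota w).
Proof.
pose bound n := (n ^ 3 + n ^ 2)%N.
have [k] := ubnP (bound (size w) - word_potential w)%N.
elim: k w => // k IHk w lt_k [u [x [Ew bu]]].
have [a na [pa la]] := normal_form u x.
have Pa : inP a.
  rewrite inPE na (perm_size pa) -bu /=; apply/eqP/perm_sumn.
  exact: perm_map.
have pw : perm_eq (nf_word a) w.
  rewrite nf_wordE Ew la -!cats1; exact: perm_cat.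
have [rest pr ltr] := words_phi Pa.
have -> : mono iota w = tau (phi a) - \sum_(v <- rest) mono iota v.
  rewrite tau_words (perm_big _ pr) big_cons addrK.
  by rewrite nf_wordE la Ew; apply: mono_perm; rewrite perm_sym.
apply: lin_spanB; first by apply: lin_span_mem; exists a.
apply: lin_span_sum => v vr.
have [sz lt] := ltr v vr.
have av : admissible v.
  by apply: (@admissible_words _ (phi a)); rewrite (perm_mem pr) inE vr orbT.
apply: IHk => //; rewrite sz (perm_size pw).
apply: leq_trans (_ : _ < bound (size w) - word_potential w)%N _; last by [].
rewrite (word_potential_perm pw) in lt; rewrite ltn_sub2l //.
apply: leq_trans lt _; rewrite /word_potential -(perm_size pw) -sz /bound.
rewrite -(size_map snd v); apply: potential_bound; rewrite size_map.
case: av => u' [x' [-> bu']].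
by rewrite /orders map_rcons sumn_rcons size_rcons addn0 -/(orders u') bu'.
Qed.

Lemma succ_subalg_lin_span v : succ_subalg iota v -> lin_span basis v.
Proof.
case/succ_subalg_tau => t ->; apply: lin_span_comb => p.
rewrite tau_words; apply: lin_span_sum => w /admissible_words.
exact: admissible_span.
Qed.

Hypothesis hfree : is_free_derperm iota.

(** The coordinate along the product a.  It vanishes on products of potential
    larger than that of a, hence on all terms of tau [b] except perhaps the
    leading one. *)
Lemma dual_functional a : inP a -> exists kappa : {scalar D},
  kappa (tau (phi a)) = 1 /\
  forall b, inP b ->
    (word_potential (nf_word a) <= word_potential (nf_word b))%N ->
    kappa (tau (phi b)) != 0 -> b = a.
Proof.
move=> Pa; have [kappa K] := coordinate hfree (nf_prefix a) (nf_last a).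
have Krest w : admissible w ->
    (word_potential (nf_word a) < word_potential w)%N ->
    kappa (mono iota w) = 0.
  case=> u [x [-> _]] lt; rewrite K.
  case: andP => // -[pu /eqP lx].
  case/negP: (negbT (ltnn (word_potential (nf_word a)))).
  apply: leq_trans lt _; rewrite (@word_potential_perm _ _ _ (nf_word a)) //.
  by rewrite nf_wordE lx -!cats1 perm_cat // perm_sym.
have Kphi b : inP b ->
    (word_potential (nf_word a) <= word_potential (nf_word b))%N ->
    kappa (tau (phi b)) = kappa (mono iota (nf_word b)).
  move=> Pb le; have [rest pr ltr] := words_phi Pb.
  rewrite tau_words (perm_big _ pr) big_cons linearD linear_sum /=.
  rewrite big_seq big1 ?addr0 // => v vr; apply: Krest.
    by apply: (@admissible_words _ (phi b)); rewrite (perm_mem pr) inE vr orbT.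
  by apply: leq_ltn_trans le _; have [] := ltr v vr.
exists kappa; split; first by rewrite Kphi // nf_wordE K perm_refl eqxx.
move=> b Pb le; rewrite Kphi // nf_wordE K.
case: andP => [[pab /eqP lab] _|_]; last by rewrite eqxx.
move: Pa Pb; rewrite !inPE => /andP[na _] /andP[nb _].
by apply: normal_inj => //; rewrite perm_sym.
Qed.

Lemma tau_phi_inj a b :
  inP a -> inP b -> tau (phi a) = tau (phi b) -> a = b.
Proof.
wlog le : a b / (word_potential (nf_word a) <= word_potential (nf_word b))%N.
  move=> H Pa Pb E.
  have [le|/ltnW le] :=
    leqP (word_potential (nf_word a)) (word_potential (nf_word b)).
    exact: H.
  by symmetry; apply: H.
move=> Pa Pb E; have [kappa [Ka Kb]] := dual_functional Pa.
by symmetry; apply: Kb => //; rewrite -E Ka oner_eq0.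
Qed.

(** The coefficients vanish one after the other, by increasing potential. *)
Lemma basis_lin_indep : lin_indep basis.
Proof.
move=> s c us sB s0.
suff H n a : inP a -> tau (phi a) \in s ->
    (word_potential (nf_word a) < n)%N -> c (tau (phi a)) = 0.
  move=> v vs; have [a Pa E] := sB v vs; rewrite E in vs *.
  exact: H vs (ltnSn _).
elim: n a => // n IHn a Pa sa lt_n.
have [kappa [Ka Kb]] := dual_functional Pa.
have := congr1 kappa s0; rewrite linear0 linear_sum (bigD1_seq _ sa us) /=.
rewrite scalarZ Ka mulr1 big_seq_cond big1 ?addr0 // => v /andP[vs neq].
have [b Pb Ev] := sB v vs; rewrite scalarZ {}Ev in vs neq *.
have [le|lt] :=
  leqP (word_potential (nf_word a)) (word_potential (nf_word b)).
  have [->|/(Kb b Pb le) Eb] := eqVneq (kappa (tau (phi b))) 0.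
    by rewrite mulr0.
  by rewrite Eb eqxx in neq.
by rewrite (IHn b) ?mul0r // (leq_trans lt).
Qed.

End Basis.

Theorem theorem5 (F : fieldType) (d : Order.disp_t) (X : orderType d)
    (D : derPermAlgType F) (iota : X -> D) (hfree : is_free_derperm iota) :
  (forall a b : nform X, inP a -> inP b ->
     tau iota (phi a) = tau iota (phi b) -> a = b) /\
  is_basis (fun v : D => exists2 a : nform X, inP a & v = tau iota (phi a))
           (succ_subalg iota).
Proof.
split; first exact: tau_phi_inj.
split; first exact: basis_lin_indep.
by move=> v; split; [exact: succ_subalg_lin_span | exact: lin_span_succ_subalg].
Qed.
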